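(* Let $a,b\in\mathbb{C}$ with $a\neq 0$ or $b\neq 0$. Then the operator $$S_{4,3}=\partial^{2}-\left(ax^{4}+bx^{3}\right)$$ is irreducible in $\mathbb{C}(x)[\partial]$.
   Context: Here $\partial=\frac{d}{dx}$ is the usual derivation of the field of rational functions $\mathbb{C}(x)$, and $\mathbb{C}(x)[\partial]$ is the (noncommutative) ring of linear differential operators with coefficients in $\mathbb{C}(x)$, with multiplication determined by $\partial f=f\partial+f'$ for $f\in\mathbb{C}(x)$. The order of an operator is its degree in $\partial$. An element of $\mathbb{C}(x)[\partial]$ is called reducible if it decomposes into a product of at least two factors of order $\geq 1$ in $\mathbb{C}(x)[\partial]$; it is irreducible if it is not reducible. *)

(* Defs.v *)
From HB Require Import structures.
From mathcomp Require Import all_boot all_order all_algebra.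
From mathcomp Require Import ring generic_quotient.
From mathcomp Require Import reals.
From mathcomp.real_closed Require Export complex.

Set Implicit Arguments.
Unset Strict Implicit.
Unset Printing Implicit Defensive.

Import GRing.Theory.
Local Open Scope ring_scope.

Record derivation (K : comNzRingType) := Derivation {
  der_fun :> K -> K;
  der_add : {morph der_fun : f g / f + g};
  der_mul : forall f g, der_fun (f * g) = der_fun f * g + f * der_fun g
}.

(* The ring K[∂] of differential operators over (K, d). An operator
   \sum_i f_i ∂^i, coefficients on the left, is stored as the polynomial with
   coefficients f_i. Only the additive group is inherited from {poly K}; the
   product is the composition of operators. *)
Definition diffop (K : comNzRingType) (d : derivation K) := {poly K}.

HB.instance Definition _ (K : comNzRingType) (d : derivation K) :=
  GRing.Zmodule.copy (diffop d) {poly K}.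

Section DiffOp.
Variables (K : comNzRingType) (d : derivation K).
Implicit Types (f g : K) (p q r : {poly K}) (A B L : diffop d).

Lemma der0 : d 0 = 0.
Proof. by apply: (addrI (d 0)); rewrite -der_add !addr0. Qed.

Lemma der1 : d 1 = 0.
Proof.
by apply: (addrI (d 1)); rewrite addr0 -{3}[1](mulr1 1) der_mul mulr1 mul1r.
Qed.

(* Left multiplication by ∂: ∂ (\sum_i f_i ∂^i) =
   \sum_i (f_i ∂^(i+1) + d f_i ∂^i). *)
Definition dmul p : {poly K} := p * 'X + \poly_(i < size p) d p`_i.

(* (\sum_i f_i ∂^i) q = \sum_i f_i (∂^i q) *)
Definition opmul p q : {poly K} := \sum_(i < size p) p`_i *: iter i dmul q.

Lemma coef_dmul p i : (dmul p)`_i = (p * 'X)`_i + d p`_i.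
Proof.
rewrite coefD coef_poly; case: ltnP => // le_pi.
by rewrite [in RHS](nth_default _ le_pi) der0.
Qed.

Lemma dmulD : {morph dmul : p q / p + q}.
Proof.
move=> p q; apply/polyP => i.
by rewrite coefD !coef_dmul mulrDl !coefD der_add addrACA.
Qed.

Lemma dmulZ f p : dmul (f *: p) = f *: dmul p + d f *: p.
Proof.
apply/polyP => i; rewrite coef_dmul coefD !coefZ coef_dmul -scalerAl coefZ der_mul.
by rewrite mulrDr -addrA [d f * _ + _]addrC.
Qed.

Lemma dmul0 : dmul 0 = 0.
Proof. by apply: (addrI (dmul 0)); rewrite -dmulD !addr0. Qed.

Lemma iter_dmulD i : {morph iter i dmul : p q / p + q}.
Proof. by move=> p q; elim: i => //= i ->; rewrite dmulD. Qed.

Lemma iter_dmul0 i : iter i dmul 0 = 0.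
Proof. by elim: i => //= i ->; rewrite dmul0. Qed.

Lemma opmul_widen n p q : (size p <= n)%N ->
  opmul p q = \sum_(i < n) p`_i *: iter i dmul q.
Proof.
move=> le_pn; rewrite /opmul (big_ord_widen n (fun i => p`_i *: iter i dmul q)) //.
rewrite big_mkcond /=; apply: eq_bigr => i _.
by case: ltnP => // /(nth_default 0)->; rewrite scale0r.
Qed.

Lemma opmulDl : left_distributive opmul +%R.
Proof.
move=> p q r; set n := maxn (size p) (size q).
rewrite !(@opmul_widen n) ?leq_maxl ?leq_maxr ?size_polyD //.
by rewrite -big_split; apply: eq_bigr => i _; rewrite coefD scalerDl.
Qed.

Lemma opmulDr : right_distributive opmul +%R.
Proof.
move=> p q r; rewrite /opmul -big_split; apply: eq_bigr => i _.
by rewrite iter_dmulD scalerDr.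
Qed.

Lemma opmul0l q : opmul 0 q = 0.
Proof. by rewrite /opmul size_poly0 big_ord0. Qed.

Lemma opmulZl f p q : opmul (f *: p) q = f *: opmul p q.
Proof.
rewrite (@opmul_widen (size p)) ?size_scale_leq // scaler_sumr.
by apply: eq_bigr => i _; rewrite coefZ scalerA.
Qed.

Lemma opmulC f q : opmul f%:P q = f *: q.
Proof.
rewrite (@opmul_widen 1) ?size_polyC_leq1 // big_ord1 /=.
by rewrite coefC.
Qed.

Lemma opmul_dmul p q : opmul (dmul p) q = dmul (opmul p q).
Proof.
have szd : (size (dmul p) <= (size p).+1)%N.
  apply/leq_sizeP => j lt_pj; rewrite coef_dmul coefMX.
  rewrite [p`_j]nth_default ?(ltnW lt_pj) // der0 addr0.
  by case: j lt_pj => //= j /(nth_default 0)->.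
have dsum (I : Type) (s : seq I) (F : I -> {poly K}) :
    dmul (\sum_(i <- s) F i) = \sum_(i <- s) dmul (F i).
  by apply: (big_morph dmul dmulD dmul0).
rewrite (opmul_widen q szd) /opmul dsum.
under eq_bigr do rewrite coef_dmul scalerDl.
under [RHS]eq_bigr do rewrite dmulZ.
rewrite !big_split /=; congr (_ + _).
  rewrite big_ord_recl coefMX /= scale0r add0r.
  by apply: eq_bigr => i _; rewrite coefMX.
by rewrite big_ord_recr /= (nth_default 0 (leqnn _)) der0 scale0r addr0.
Qed.

Lemma opmulA : associative opmul.
Proof.
move=> p q r; rewrite [LHS]/opmul [opmul p q]/opmul.
rewrite (big_morph (opmul^~ r) (fun p q => opmulDl p q r) (opmul0l r)).
apply: eq_bigr => i _; rewrite opmulZl; congr (_ *: _).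
by elim: (nat_of_ord i) => //= k ->; rewrite opmul_dmul.
Qed.

Lemma opmul1l : left_id 1%:P opmul.
Proof. by move=> q; rewrite opmulC scale1r. Qed.

Lemma iter_dmul1 i : iter i dmul 1%:P = 'X^i.
Proof.
elim: i => [|i IHi] /=; first by rewrite expr0.
rewrite IHi; apply/polyP => j; rewrite coef_dmul -exprSr !coefXn.
by case: (j == i); rewrite ?der0 ?der1 addr0.
Qed.

Lemma opmul1r : right_id 1%:P opmul.
Proof.
move=> p; rewrite /opmul; under eq_bigr do rewrite iter_dmul1.
by rewrite -poly_def coefK.
Qed.

Lemma diffop1_neq0 : (1%:P : diffop d) != 0.
Proof. exact: (oner_neq0 {poly K}). Qed.

HB.instance Definition _ := GRing.Zmodule_isNzRing.Build (diffop d)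
  opmulA opmul1l opmul1r opmulDl opmulDr diffop1_neq0.

Definition op_cst f : diffop d := f%:P.
Definition op_d : diffop d := 'X.

Lemma op_d_cst f : op_d * op_cst f = op_cst f * op_d + op_cst (d f).
Proof.
have -> : op_d * op_cst f = dmul f%:P.
  transitivity (opmul (dmul 1%:P) f%:P); last by rewrite opmul_dmul opmul1l.
  by congr opmul; rewrite -[RHS]/(iter 1 dmul 1%:P) iter_dmul1.
have -> : op_cst f * op_d = f%:P * 'X :> {poly K}.
  by rewrite mul_polyC; exact: opmulC.
apply/polyP => i; rewrite coef_dmul coefD; congr (_ + _).
by rewrite !coefC; case: eqP => // _; rewrite der0.
Qed.

Lemma op_cst_is_zmod_morphism : zmod_morphism op_cst.
Proof. exact: polyCB. Qed.

Lemma op_cst_is_monoid_morphism : monoid_morphism op_cst.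
Proof.
split=> // f g; rewrite /op_cst polyCM mul_polyC.
by symmetry; exact: opmulC.
Qed.

HB.instance Definition _ := GRing.isZmodMorphism.Build K (diffop d) op_cst
  op_cst_is_zmod_morphism.
HB.instance Definition _ := GRing.isMonoidMorphism.Build K (diffop d) op_cst
  op_cst_is_monoid_morphism.

Lemma op_dX n : op_d ^+ n = 'X^n :> {poly K}.
Proof.
rewrite -iter_dmul1; elim: n => // n IHn; rewrite exprS iterS -IHn.
transitivity (opmul (dmul 1%:P) (op_d ^+ n)).
  by congr opmul; rewrite -[RHS]/(iter 1 dmul 1%:P) iter_dmul1.
by rewrite opmul_dmul opmul1l.
Qed.

Lemma diffopE L :
  L = \sum_(i < size (L : {poly K})) op_cst (L : {poly K})`_i * op_d ^+ i.
Proof.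
rewrite -{1}[L](@coefK K) poly_def; apply: eq_bigr => i _.
by rewrite -op_dX; symmetry; exact: opmulC.
Qed.

(* The zero operator gets order 0. *)
Definition order L : nat := (size (L : {poly K})).-1.

Definition reducible_op L : Prop :=
  exists s : seq (diffop d),
    [/\ (2 <= size s)%N,
        (forall A, A \in s -> (1 <= order A)%N)
      & L = \prod_(A <- s) A].

Definition irreducible_op L : Prop := ~ reducible_op L.

End DiffOp.

Arguments op_cst {K} d f.
Arguments op_d {K} d.

Notation "p %:F" := (FracField.tofrac p) : ring_scope.

Section RatDeriv.
Variable F : fieldType.
Implicit Types (f g : {fraction {poly F}}) (p q : {poly F}).

(* Quotient rule, on a representative; rat_deriv_div shows that the choice of
   the representative is irrelevant. *)
Definition rat_deriv f : {fraction {poly F}} :=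
  let n := \n_(repr f) in let m := \d_(repr f) in
  (n^`() * m - n * m^`())%:F / m%:F ^+ 2.

Lemma frac_numden f : f = (\n_(repr f))%:F / (\d_(repr f))%:F.
Proof.
have nz := denom_ratioP (repr f).
apply: (canRL (mulfK _)); first by rewrite tofrac_eq0.
rewrite -{1}[f]reprK; set x := repr f; unlock tofrac.
rewrite -[LHS](FracField.pi_mul x (Ratio \d_x 1)).
apply/eqmodP; rewrite /= FracField.equivfE /FracField.mulf.
by rewrite !numden_Ratio ?mulr1 ?oner_neq0 // mulrC.
Qed.

Lemma rat_deriv_div p q : q != 0 ->
  rat_deriv (p%:F / q%:F) = (p^`() * q - p * q^`())%:F / q%:F ^+ 2.
Proof.
move=> q0; have m0 := denom_ratioP (repr (p%:F / q%:F)).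
have e := frac_numden (p%:F / q%:F).
rewrite /rat_deriv; move: (\n_ _) (\d_ _) m0 e => n m m0 e.
have qF : q%:F != 0 by rewrite tofrac_eq0.
have mF : m%:F != 0 by rewrite tofrac_eq0.
have {}e : p * m = n * q.
  apply/eqP.
  rewrite -(tofrac_eq (p * m)).
  rewrite !tofracM.
  rewrite -(eqr_div _ _ qF mF).
  apply/eqP.
  exact: e.
have de : p^`() * m + p * m^`() = n^`() * q + n * q^`().
  by rewrite -!derivM e.
apply/eqP; rewrite (eqr_div _ _ (expf_neq0 2 mF) (expf_neq0 2 qF)).
rewrite -(tofracXn 2 q) -(tofracXn 2 m).
rewrite -!tofracM.
rewrite tofrac_eq.
rewrite -subr_eq0.
have -> : (n^`() * m - n * m^`()) * q ^+ 2 - (p^`() * q - p * q^`()) * m ^+ 2 =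
  m * q * (n^`() * q + n * q^`() - (p^`() * m + p * m^`()))
  + (q * m^`() + m * q^`()) * (p * m - n * q) by ring.
by rewrite de e !subrr !mulr0 addr0.
Qed.

Lemma rat_deriv_poly p : rat_deriv p%:F = p^`()%:F.
Proof.
rewrite -[p%:F]divr1 -tofrac1 rat_deriv_div ?oner_neq0 //.
by rewrite derivE mulr0 subr0 mulr1 tofrac1 expr1n divr1.
Qed.

Lemma rat_derivD : {morph rat_deriv : f g / f + g}.
Proof.
move=> f g; have p0 := denom_ratioP (repr f); have q0 := denom_ratioP (repr g).
rewrite (frac_numden f) (frac_numden g).
move: (\n_(repr f)) (\d_(repr f)) (\n_(repr g)) (\d_(repr g)) p0 q0.
move=> n p m q p0 q0.
have pF : p%:F != 0 by rewrite tofrac_eq0.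
have qF : q%:F != 0 by rewrite tofrac_eq0.
rewrite (addf_div _ _ pF qF) -!tofracM -tofracD.
rewrite (rat_deriv_div _ p0) (rat_deriv_div _ q0).
rewrite (rat_deriv_div _ (mulf_neq0 p0 q0)).
rewrite (addf_div _ _ (expf_neq0 2 pF) (expf_neq0 2 qF)).
rewrite -!(tofracXn 2) -!tofracM -tofracD.
by congr (_%:F / _%:F); rewrite ?derivE; ring.
Qed.

Lemma rat_derivM f g :
  rat_deriv (f * g) = rat_deriv f * g + f * rat_deriv g.
Proof.
have p0 := denom_ratioP (repr f); have q0 := denom_ratioP (repr g).
rewrite (frac_numden f) (frac_numden g).
move: (\n_(repr f)) (\d_(repr f)) (\n_(repr g)) (\d_(repr g)) p0 q0.
move=> n p m q p0 q0.
have pF : p%:F != 0 by rewrite tofrac_eq0.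
have qF : q%:F != 0 by rewrite tofrac_eq0.
rewrite mulf_div -!tofracM.
rewrite (rat_deriv_div _ p0) (rat_deriv_div _ q0).
rewrite (rat_deriv_div _ (mulf_neq0 p0 q0)) !mulf_div.
rewrite (addf_div _ _ (mulf_neq0 (expf_neq0 2 pF) qF)
                      (mulf_neq0 pF (expf_neq0 2 qF))).
rewrite -!(tofracXn 2) -!tofracM -tofracD.
apply/eqP; rewrite eqr_div; last first.
- by rewrite tofrac_eq0 !mulf_neq0 ?expf_neq0.
- by rewrite tofrac_eq0 expf_neq0 ?mulf_neq0.
by rewrite -!tofracM tofrac_eq !derivM; apply/eqP; ring.
Qed.

Definition ddx : derivation {fraction {poly F}} :=
  Derivation rat_derivD rat_derivM.

End RatDeriv.

Arguments ddx F : clear implicits.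

Definition S43 (R : realType) (a b : R[i]) : diffop (ddx R[i]) :=
  op_d (ddx R[i]) ^+ 2 - op_cst (ddx R[i]) (a *: 'X^4 + b *: 'X^3)%:F.

(* Main.v *)
From mathcomp Require Import classical_sets functions topology normedtype.
From mathcomp Require Import sequences derive realfun exp.
Require Import Defs.
From mathcomp Require Import all_boot all_order all_algebra.
From mathcomp Require Import ring lra.
From mathcomp Require Import reals.
From mathcomp.real_closed Require Import complex polyrcf.

Set Implicit Arguments.
Unset Strict Implicit.
Unset Printing Implicit Defensive.

Import Order.TTheory GRing.Theory Num.Theory.
Import numFieldNormedType.Exports.
Import complex.
Local Open Scope ring_scope.

(** A factorization splits the operator D^2 - r, with r = a x^4 + b x^3, into
two factors of order 1. The right one has a solution y with y'/y = u rational,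
and then u' + u^2 = r ([riccati_of_factors]). A pole of u must be simple with
residue 1 because r has no pole, so u = w + q'/q with polynomials w and q
([riccati_log_derivative]). In other words y = q e^W with W' = w.

Comparing growth at infinity makes w quadratic, and the exponents at infinity
leave one parameter N = 1 + deg q, a positive integer: after rescaling x, the
potential becomes r = 4 N^2 (x^4 + 2 x^3) and W = N (2 x^3/3 + x^2 - x)
([normalized_solution]). All coefficients are now real, so the real and the
imaginary parts of q are solutions too, and q may be taken real.

That such a q does not exist is a global fact, invisible to local exponents. It
comes from conservation of flux. Put y(rho) = (q e^W)(rho z) on the ray from 0
in the direction z. The derivative of Im(conj(y) y') along the ray is
Im(z^2 r(rho z)) |y|^2. For z = 1 + i and for z = 1 + 4i, the factor e^W decays
along the ray, so the flux tends to 0 at infinity; but Im(z^2 r(rho z)) is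
negative on the first ray and positive on the second. Hence the flux at the
origin, which is Im(z) times the real number q(0) (q' + w q)(0) because q and
w are real, is positive according to the first ray and negative according to
the second ([flux_start_sign], [real_amplitude_eq0]).

The factor |e^W|^2 is split off the flux, so that what remains is a real
polynomial h in rho, and h' + 2 Re(z w) h has constant sign. The decay at
infinity then becomes a comparison of leading coefficients
([start_lt0_of_weighted_monotone]). *)

(** * The equation for the polynomial factor of a solution *)

Section Amplitude.
Variable F : comNzRingType.

(** The conjugate e^-W (D^2 - r) e^W with W' = w, applied to p: it vanishes
exactly when p e^W solves y'' = r y. *)
Definition amplitude_op (w r p : {poly F}) : {poly F} :=
  p^`()^`() + (w * p^`()) *+ 2 + (w^`() + w ^+ 2 - r) * p.

End Amplitude.

(** * From a factorization to a rational solution of the Riccati equation *)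

Section Factor.
Variables (K : fieldType) (d : derivation K).
Implicit Types (A B : diffop d) (p q : {poly K}).

Lemma size_iter_dmul i q : (size (iter i (dmul d) q) <= i + size q)%N.
Proof.
elim: i => //= i IHi; apply/leq_sizeP => j ij; rewrite coef_dmul coefMX.
have jz : (iter i (dmul d) q)`_j = 0.
  by rewrite nth_default // (leq_trans IHi) // ltnW.
rewrite jz der0 addr0; case: j ij {jz} => //= j ij.
by rewrite nth_default // (leq_trans IHi).
Qed.

Lemma lead_iter_dmul i q : q != 0 ->
  (iter i (dmul d) q)`_(i + (size q).-1) = lead_coef q.
Proof.
move=> q0; elim: i => //= i IHi; rewrite addSn coef_dmul coefMX /= IHi.
rewrite nth_default ?der0 ?addr0 //.
by rewrite -addnS prednK ?size_poly_gt0 // size_iter_dmul.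
Qed.

(** The leading coefficient is multiplicative even though the ring is not
commutative: moving D past a coefficient only creates terms of lower order. *)
Lemma order_mul A B : A != 0 -> B != 0 ->
  A * B != 0 /\ Defs.order (A * B) = (Defs.order A + Defs.order B)%N.
Proof.
rewrite /Defs.order -[A * B]/(opmul d A B); move: A B => p q p0 q0.
have p_gt0 : (0 < size p)%N by rewrite size_poly_gt0.
have q_gt0 : (0 < size q)%N by rewrite size_poly_gt0.
pose n := ((size p).-1 + (size q).-1)%N.
have top : (opmul d p q)`_n = lead_coef p * lead_coef q.
  rewrite /opmul coef_sum -(prednK p_gt0) big_ord_recr /= coefZ lead_iter_dmul //.
  rewrite big1 ?add0r // => i _; rewrite coefZ [X in _ * X]nth_default ?mulr0 //.
  apply: leq_trans (size_iter_dmul _ _) _.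
  by rewrite -{1}(prednK q_gt0) addnS -addSn leq_add2r.
have szle : (size (opmul d p q) <= n.+1)%N.
  apply/leq_sizeP => j nj; rewrite /opmul coef_sum big1 // => i _.
  rewrite coefZ [X in _ * X]nth_default ?mulr0 //.
  apply: leq_trans (size_iter_dmul _ _) _; apply: leq_trans nj.
  rewrite /n -addnS prednK // leq_add2r -ltnS prednK //.
have top_neq0 : (opmul d p q)`_n != 0 by rewrite top mulf_neq0 ?lead_coef_eq0.
have szge : (n < size (opmul d p q))%N.
  by rewrite ltnNge; apply: contra top_neq0 => /leq_sizeP ->.
split; first by rewrite -size_poly_gt0 (leq_ltn_trans _ szge).
by rewrite (_ : size _ = n.+1) //; apply/eqP; rewrite eqn_leq szle szge.
Qed.

Lemma order_gt0_neq0 A : (0 < Defs.order A)%N -> A != 0.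
Proof. by apply: contraTneq => ->; rewrite /Defs.order size_poly0. Qed.

Lemma order_prod (s : seq (diffop d)) :
  (forall A, A \in s -> (1 <= Defs.order A)%N) ->
  \prod_(A <- s) A != 0 /\ (size s <= Defs.order (\prod_(A <- s) A)%R)%N.
Proof.
elim: s => [|A s IHs] s1; first by rewrite big_nil; split=> //; exact: oner_neq0.
have A1 : (1 <= Defs.order A)%N by apply: s1; rewrite mem_head.
have [|P0 Ps] := IHs; first by move=> B Bs; apply: s1; rewrite in_cons Bs orbT.
have [AP0 AP] := order_mul (order_gt0_neq0 A1) P0.
by rewrite big_cons AP; split=> //; rewrite -[size _]/(1 + size s)%N leq_add.
Qed.

Lemma order2_factors (L : diffop d) : Defs.order L = 2%N -> reducible_op L ->
  exists A B, [/\ Defs.order A = 1%N, Defs.order B = 1%N & L = A * B].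
Proof.
move=> L2 [[|A [|B s]] [//= _ s1 LE]] //.
have A1 : (1 <= Defs.order A)%N by apply: s1; rewrite mem_head.
have [|P0 Ps] := @order_prod (B :: s).
  by move=> C Cs; apply: s1; rewrite in_cons Cs orbT.
have [_] := order_mul (order_gt0_neq0 A1) P0.
rewrite big_cons in LE; rewrite -LE L2.
have {Ps} P1 := leq_trans (ltn0Sn _) Ps.
move=> L2E; exists A, (\prod_(C <- B :: s) C); split=> //; move: A1 P1 L2E.
all: case: (Defs.order A) => [|[|a]] //; case: (Defs.order _) => [|[|b]] //.
all: by rewrite ?addnS.
Qed.

(** Here u is the logarithmic derivative of a solution of the right factor
q1 D + q0, that is, u = - q0 / q1. *)
Lemma riccati_of_factors (r : K) A B : Defs.order A = 1%N -> Defs.order B = 1%N ->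
  op_d d ^+ 2 - op_cst d r = A * B -> exists u, d u + u ^+ 2 = r.
Proof.
rewrite /Defs.order => A1 B1 E.
have sA : size (A : {poly K}) = 2 by case: (size _) A1 => [|[|[|]]].
have sB : size (B : {poly K}) = 2 by case: (size _) B1 => [|[|[|]]].
have {}E i : ('X^2 - r%:P : {poly K})`_i = (opmul d A B)`_i.
  by rewrite -[opmul d A B]/(A * B) -E op_dX.
set p : {poly K} := A in E sA; set q : {poly K} := B in E sB.
have cE i : (opmul d p q)`_i = p`_0 * q`_i + p`_1 * ((q * 'X)`_i + d q`_i).
  by rewrite /opmul sA !big_ord_recl big_ord0 /= addr0 coefD !coefZ coef_dmul.
have q2 : q`_2 = 0 by rewrite nth_default // sB.
have := E 0%N; have := E 1%N; have := E 2%N.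
rewrite !cE !coefB !coefXn !coefC !coefMX /= q2 der0.
rewrite !(mulr0, add0r, addr0, subr0, sub0r) => E2 E1 E0.
have h0 : q`_1 != 0 by apply: contra_eq_neq E2 => ->; rewrite mulr0 oner_neq0.
pose u := - (q`_0 / q`_1).
have q0E : q`_0 = - (u * q`_1) by rewrite /u mulNr opprK divfK.
exists u.
have dN x : d (- x) = - d x.
  by apply/eqP; rewrite -addr_eq0 -der_add addNr der0.
move: E1 E0; rewrite q0E dN der_mul => E1 E0.
have -> : r = - (- r) by rewrite opprK.
rewrite E0.
have -> : p`_0 * - (u * q`_1) = - u * (p`_0 * q`_1) by ring.
have -> : p`_0 * q`_1 = - (p`_1 * (- (u * q`_1) + d q`_1)).
  by apply/eqP; rewrite -addr_eq0 -E1 oppr0.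
transitivity ((p`_1 * q`_1) * (d u + u ^+ 2)); first by rewrite -E2 mul1r.
ring.
Qed.

End Factor.

Section Riccati.
Variable F : fieldType.
Implicit Types (p q r w : {poly F}).

Lemma coprime_fraction (f : {fraction {poly F}}) :
  exists p q, [/\ q != 0, coprimep p q & f = p%:F / q%:F].
Proof.
have := frac_numden f; have := denom_ratioP (repr f).
move: (\n_ _) (\d_ _) => n m m0 fE.
have g0 : gcdp n m != 0 by rewrite gcdp_eq0 negb_and m0 orbT.
have nE := divpK (dvdp_gcdl n m); have mE := divpK (dvdp_gcdr n m).
have m10 : m %/ gcdp n m != 0 by apply: contraNneq m0 => e; rewrite -mE e mul0r.
exists (n %/ gcdp n m), (m %/ gcdp n m); split => //.
  by rewrite coprimep_div_gcd // m0 orbT.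
rewrite fE; move: (gcdp n m) g0 nE mE => g g0 nE mE.
by rewrite -{1}nE -{1}mE !tofracM -mulf_div divff ?mulr1 ?tofrac_eq0.
Qed.

(** Clearing denominators in u = p / q gives p' q - p q' + p^2 = r q^2, so q
divides p (p - q') and, being coprime to p, divides p - q'. This is the
statement that every pole of u is simple with residue 1. *)
Lemma riccati_log_derivative r (u : {fraction {poly F}}) :
  ddx F u + u ^+ 2 = r%:F ->
  exists q w, q != 0 /\ amplitude_op w r q = 0.
Proof.
have [p [q [q0 cop ->]]] := coprime_fraction u.
rewrite -[ddx F _]/(rat_deriv _) (rat_deriv_div _ q0) expr_div_n -mulrDl.
have qF : q%:F != 0 by rewrite tofrac_eq0.
move/(canRL (divfK (expf_neq0 2 qF))).
rewrite -!tofracXn -tofracD -tofracM => /eqP; rewrite tofrac_eq => /eqP E.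
have dvd : q %| p * (p - q^`()).
  apply/dvdpP; exists (r * q - p^`()); rewrite mulrBl -mulrA -expr2 -E; ring.
move: dvd; rewrite mulrC Gauss_dvdpl 1?coprimep_sym // => /dvdpP[w wE].
have pE : p = q^`() + w * q by rewrite -wE addrC subrK.
exists q, w; split=> //; apply: (mulfI q0); rewrite mulr0.
move: E; rewrite pE derivD derivM => /eqP; rewrite -subr_eq0 => /eqP <-.
rewrite /amplitude_op; ring.
Qed.
End Riccati.

(** * Reduction to a one-parameter family *)

Section Normalize.
Variable F : numFieldType.

Definition scaled_potential (N : F) : {poly F} :=
  (4 * N ^+ 2) *: ('X^4 + 2 *: 'X^3).
(** A primitive of N (2 x^2 + 2 x - 1), which is the polynomial part at infinity
of the square root of the scaled potential. *)
Definition scaled_action (N : F) : {poly F} :=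
  N *: ((2 / 3) *: 'X^3 + 'X^2 - 'X).

Implicit Types (p q r w s : {poly F}) (a b : F).

(** The terms q'' and w q' lose a degree with respect to q and w q, so s must
lose one with respect to w. *)
Lemma size_zero_order_coef q w s : q != 0 ->
  q^`()^`() + (w * q^`()) *+ 2 + s * q = 0 -> (size s <= (size w).-1)%N.
Proof.
move=> q0 ode; have [->|s0] := eqVneq s 0; first by rewrite size_poly0.
have sqE : s * q = - (q^`()^`() + (w * q^`()) *+ 2).
  by apply/eqP; rewrite -addr_eq0 addrC ode.
have q_gt0 : (0 < size q)%N by rewrite size_poly_gt0.
have s_gt0 : (0 < size s)%N by rewrite size_poly_gt0.
have dq : (size q^`() <= (size q).-1)%N by rewrite -ltnS prednK // lt_size_deriv.
have d2q : (size q^`()^`() <= (size q).-2)%N.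
  have [->|dq0] := eqVneq q^`() 0; first by rewrite deriv0 size_poly0.
  have := leq_trans (lt_size_deriv dq0) dq; move: (size _) (size _).-1 => m n.
  by case: n.
have szM : (size (w * q^`())%R <= (size w).-1 + (size q).-1)%N.
  have [->|w0] := eqVneq w 0; first by rewrite mul0r size_poly0.
  apply: leq_trans (size_polyMleq _ _) _.
  have : (0 < size w)%N by rewrite size_poly_gt0.
  by case: (size w) => //= m _; rewrite leq_add2l.
have : (size (s * q)%R <= (size w).-1 + (size q).-1)%N.
  rewrite sqE size_polyN; apply: leq_trans (size_polyD _ _) _.
  rewrite geq_max mulr2n (leq_trans d2q) /=; last first.
    by apply: leq_trans (leq_pred _) (leq_addl _ _).
  by apply: leq_trans (size_polyD _ _) _; rewrite maxnn.
by rewrite size_mul // -(prednK q_gt0) addnS /= leq_add2r.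
Qed.

(** Write s = w' + w^2 - r. Since s and w' have smaller degree than w, the degree
of r is twice that of w, hence even; this excludes a = 0 and forces deg w = 2.
The coefficients of r - w^2 of degree 2 to 4 then vanish. The last relation is
the top coefficient of the equation, in degree deg q + 1. *)
Lemma quartic_shape a b q w : a != 0 \/ b != 0 -> q != 0 ->
  amplitude_op w (a *: 'X^4 + b *: 'X^3) q = 0 ->
  [/\ size w = 3, a = w`_2 ^+ 2, b = (w`_2 * w`_1) *+ 2,
      w`_1 ^+ 2 = - (w`_2 * w`_0) *+ 2
    & w`_1 * w`_0 = - (w`_2 * (size q)%:R)].
Proof.
rewrite /amplitude_op => ab q0 ode; have ss := size_zero_order_coef q0 ode.
set r := a *: 'X^4 + b *: 'X^3 in ode ss; set s := w^`() + w ^+ 2 - r in ode ss.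
have rE i : r`_i = a * (i == 4%N)%:R + b * (i == 3%N)%:R.
  by rewrite coefD !coefZ !coefXn.
have rw : r = w ^+ 2 + (w^`() - s) by rewrite /s; ring.
have r_neq0 : r != 0.
  apply/eqP => r0; case: ab.
    by have := rE 4; rewrite r0 coef0 /= mulr1 mulr0 addr0 => <-; rewrite eqxx.
  by have := rE 3; rewrite r0 coef0 /= mulr1 mulr0 add0r => <-; rewrite eqxx.
have w0 : w != 0.
  apply: contraNneq r_neq0 => w0; rewrite rw w0 deriv0 expr0n add0r sub0r.
  by move: ss; rewrite w0 size_poly0 size_poly_leq0 => /eqP ->; rewrite oppr0.
have w_gt0 : (0 < size w)%N by rewrite size_poly_gt0.
have sds : (size (w^`() - s)%R <= (size w).-1)%N.
  apply: leq_trans (size_polyD _ _) _; rewrite size_polyN geq_max ss andbT.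
  by rewrite -ltnS prednK // lt_size_deriv.
have szw2 : size (w ^+ 2) = (size w + size w).-1 by rewrite expr2 size_mul.
have szr : size r = (size w + size w).-1.
  rewrite rw size_polyDl szw2 //; apply: leq_ltn_trans sds _.
  by move: w_gt0; case: (size w) => //= m _; rewrite addnS ltnS leq_addl.
have szr5 : (size r <= 5)%N.
  by apply/leq_sizeP => -[|[|[|[|[|j]]]]] // _; rewrite rE !mulr0 addr0.
have szr4 : (3 < size r)%N.
  rewrite ltnNge; apply/negP => /leq_sizeP r3; case: ab; apply/negP; rewrite negbK.
    by have := rE 4; rewrite r3 //= mulr1 mulr0 addr0 => <-.
  by have := rE 3; rewrite r3 //= mulr1 mulr0 add0r => <-.
have w3 : size w = 3.
  move: szr5 szr4; rewrite szr; case: (size w) => [|[|[|[|m]]]] //.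
  by rewrite !addnS.
have wi i : (2 < i)%N -> w`_i = 0 by move=> ?; rewrite nth_default ?w3.
have w2E1 : (w ^+ 2)`_1 = (w`_1 * w`_0) *+ 2.
  by rewrite expr2 coefM !big_ord_recl big_ord0 /=; ring.
have w2E2 : (w ^+ 2)`_2 = w`_1 ^+ 2 + (w`_2 * w`_0) *+ 2.
  by rewrite expr2 coefM !big_ord_recl big_ord0 /=; ring.
have s1 : s`_1 = w`_2 *+ 2 + (w`_1 * w`_0) *+ 2.
  by rewrite /s coefB coefD coef_deriv w2E1 rE /= !mulr0 addr0 subr0.
have s_high i : (2 <= i)%N -> s`_i = 0.
  by move=> i2; rewrite nth_default // (leq_trans ss) // w3.
split=> //.
- have := s_high 4%N isT; rewrite /s coefB coefD coef_deriv rE (wi 5) //=.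
  rewrite expr2 coefM !big_ord_recl big_ord0 /= /bump /= (wi 3) // (wi 4) //.
  rewrite !(mulr0, mul0r, addr0, add0r) mul0rn add0r mulr1 => /eqP.
  by rewrite subr_eq0 => /eqP.
- have := s_high 3%N isT; rewrite /s coefB coefD coef_deriv rE (wi 4) //=.
  rewrite expr2 coefM !big_ord_recl big_ord0 /= /bump /= (wi 3) //.
  rewrite !(mulr0, mul0r, addr0, add0r) mul0rn add0r mulr1 => /eqP.
  by rewrite subr_eq0 mulrC => /eqP <-.
- have := s_high 2%N isT; rewrite /s coefB coefD coef_deriv w2E2 rE (wi 3%N) //=.
  rewrite !mulr0 addr0 subr0 mul0rn add0r => /eqP.
  by rewrite addr_eq0 => /eqP ->; rewrite mulNrn.
pose n := (size q).-1; have qn : q`_n != 0 by rewrite -lead_coefE lead_coef_eq0.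
have nE : size q = n.+1 by rewrite prednK // size_poly_gt0.
have qhi i : (n < i)%N -> q`_i = 0 by move=> ni; rewrite nth_default // nE.
have wP : w = w`_2 *: 'X^2 + w`_1 *: 'X + (w`_0)%:P.
  apply/polyP => i; rewrite !coefD !coefZ coefXn coefX coefC.
  by case: i => [|[|[|i]]] /=; rewrite ?mulr0 ?mulr1 ?add0r ?addr0 // wi.
clearbody s.
have sP : s = s`_1 *: 'X + (s`_0)%:P.
  apply/polyP => i; rewrite coefD coefZ coefX coefC.
  by case: i => [|[|i]] /=; rewrite ?mulr0 ?mulr1 ?add0r ?addr0 // s_high.
have := congr1 (fun p : {poly F} => p`_n.+1) ode.
rewrite [in w * _]wP [in s * _]sP s1 !coefD coef0 !mulrDl !coefD.
rewrite -!scalerAl !coefZ.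
rewrite coefXnM !coefXM !mul_polyC !coefZ !coef_deriv.
have q3 : q`_n.+3 = 0 by apply: qhi; rewrite ltnS ltnW.
have q2 : q`_n.+2 = 0 by apply: qhi; rewrite ltnS leqnSn.
have q1 : q`_n.+1 = 0 by apply: qhi.
rewrite q3 q2 q1 !mul0rn /=.
have -> : (if (n.+1 < 2)%N then 0 else q`_(n.+1 - 2).+1 *+ (n.+1 - 2).+1) =
    q`_n *+ n.
  by case: (n) => //= k; rewrite subSS subn1.
move=> top; apply/eqP; rewrite -addr_eq0 nE -(mulrI_eq0 _ (mulfI qn)).
rewrite -(mulrI_eq0 _ (mulfI (_ : 2 != 0))) ?pnatr_eq0 //; apply/eqP.
by apply: etrans top; rewrite -natr1; ring.
Qed.

(** The relations between the coefficients of w leave a scale t = w_2 / w_1 and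
N = size q: w = t v(t x), where v = N (2 x^2 + 2 x - 1), and similarly for the
potential. The substitution of x / t for x removes t. *)
Lemma normalized_solution a b q w : a != 0 \/ b != 0 -> q != 0 ->
  amplitude_op w (a *: 'X^4 + b *: 'X^3) q = 0 ->
  let W := scaled_action (size q)%:R in
  exists2 p : {poly F}, p != 0 &
    amplitude_op W^`() (scaled_potential (size q)%:R) p = 0.
Proof.
move=> ab q0 ode W; have [w3 aE bE w10 w1w0] := quartic_shape ab q0 ode.
set N : F := (size q)%:R in W w1w0 *.
have N0 : N != 0 by rewrite pnatr_eq0 size_poly_eq0.
have w2_neq0 : w`_2 != 0.
  have <- : lead_coef w = w`_2 by rewrite lead_coefE w3.
  by rewrite lead_coef_eq0 -size_poly_eq0 w3.
have w1_neq0 : w`_1 != 0.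
  by apply: contra_eq_neq w1w0 => ->; rewrite mul0r eq_sym oppr_eq0 mulf_neq0.
pose t := w`_2 / w`_1; have t0 : t != 0 by rewrite mulf_neq0 ?invr_eq0.
have w0E : w`_0 = - (N * t).
  by apply: (mulfI w1_neq0); rewrite w1w0 /t; field.
have w1E : w`_1 = 2 * N * t ^+ 2.
  apply: (mulfI w1_neq0); rewrite -expr2 w10 w0E /t; field.
  exact: w1_neq0.
have w2E : w`_2 = 2 * N * t ^+ 3.
  by rewrite exprS mulrCA -w1E /t divfK.
clearbody t.
have wP : w = w`_2 *: 'X^2 + w`_1 *: 'X + (w`_0)%:P.
  apply/polyP => i; rewrite !coefD !coefZ coefXn coefX coefC.
  case: i => [|[|[|i]]] /=; rewrite ?mulr0 ?mulr1 ?add0r ?addr0 //.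
  by rewrite nth_default ?w3.
pose scale (p : {poly F}) := p \Po (t^-1 *: 'X).
have deriv_scale p : scale p^`() = t *: (scale p)^`().
  by rewrite /scale deriv_comp derivZ derivX -scalerAr mulr1 scalerA divff ?scale1r.
have wS : scale w = t *: W^`().
  have -> : W^`() = N *: (2 *: 'X^2 + 2 *: 'X - 1).
    rewrite /W /scaled_action derivZ derivB derivD derivZ !derivXn derivX.
    rewrite -(scaler_nat 3 'X^2) -(scaler_nat 2 'X) scalerA.
    by rewrite (_ : 2 / 3 * 3 = 2) //; field.
  rewrite wP /scale !comp_polyD !comp_polyZ comp_polyX comp_polyC comp_Xn_poly.
  rewrite w0E w1E w2E exprZn !scalerA.
  rewrite (_ : 2 * N * t ^+ 3 * _ = 2 * N * t); last by field.
  rewrite (_ : 2 * N * t ^+ 2 * _ = 2 * N * t); last by field.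
  rewrite -!mul_polyC polyCN !polyCM; ring.
set r := a *: 'X^4 + b *: 'X^3 in ode; rewrite /amplitude_op in ode *.
have rS : scale r = t ^+ 2 *: scaled_potential N.
  rewrite /r /scale /scaled_potential comp_polyD !comp_polyZ !comp_Xn_poly.
  rewrite aE bE w1E w2E.
  rewrite (exprZn _ 'X 4) (exprZn _ 'X 3) !scalerDr !scalerA.
  by congr (_ *: _ + _ *: _); field.
clearbody r.
have scaleD p1 p2 : scale (p1 + p2) = scale p1 + scale p2 by exact: comp_polyD.
have scaleN p1 : scale (- p1) = - scale p1 by rewrite /scale raddfN.
have scaleM p1 p2 : scale (p1 * p2) = scale p1 * scale p2 by exact: comp_polyM.
have scale0 : scale 0 = 0 by exact: comp_poly0.
exists (scale q).
  rewrite -size_poly_eq0 size_comp_poly2 ?size_poly_eq0 //.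
  by rewrite size_scale ?size_polyX ?invr_eq0.
clearbody scale.
have := congr1 scale ode; rewrite mulr2n expr2 !(scaleD, scaleN, scaleM).
rewrite !deriv_scale wS rS !derivZ scale0.
move=> E; have t2 : (t ^+ 2)%:P != 0 :> {poly F} by rewrite polyC_eq0 expf_neq0.
apply: (mulfI t2); rewrite mulr0 -[RHS]E -!mul_polyC !polyC_exp; ring.
Qed.
End Normalize.

(** * Monotonicity with an exponential weight *)

Section Decay.
Variable R : realType.
Implicit Types h G : {poly R}.

(** The derivative of h e^G is (h' + G' h) e^G, so h e^G increases on the
half-line and keeps the sign it has at 0. *)
Lemma nonneg_of_weighted_monotone h G :
  (forall x : R, 0 <= x -> 0 <= (h^`() + G^`() * h).[x]) -> 0 <= h.[0] ->
  forall x : R, 0 <= x -> 0 <= h.[x].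
Proof.
move=> f_ge0 h0 x x0.
pose F : R -> R := horner h * (@expR R \o horner G).
have dF (t : R) : is_derive t (1 : R) F ((h^`() + G^`() * h).[t] * expR G.[t]).
  apply: trigger_derive.
  rewrite !hornerE /= /GRing.scale /=; ring.
have F_homo : F 0 <= F x.
  apply: (@ger0_derive1_le_cc R F 0 x _ _ _ 0 x) => //.
  - move=> t /itvP t0x; rewrite derive1E (@derive_val _ _ _ _ _ _ _ (dF t)).
    by rewrite mulr_ge0 ?expR_ge0 ?f_ge0 ?t0x.
  - apply: derivable_within_continuous => t _; exact: ex_derive.
  - by rewrite in_itv /= lexx.
  - by rewrite in_itv /= lexx x0.
rewrite -(pmulr_lge0 _ (expR_gt0 G.[x])).
by apply: le_trans F_homo; rewrite mulr_ge0 ?expR_ge0.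
Qed.

Lemma lead_coef_of_nonneg (p : {poly R}) :
  (forall x : R, 0 <= x -> 0 <= p.[x]) -> 0 <= lead_coef p.
Proof.
move=> p_ge0; rewrite leNgt; apply/negP => lp.
have [|n Hn] := @poly_pinfty_gt_lc R (- p); first by rewrite lead_coefN oppr_gt0.
have := Hn (Num.max n 0); rewrite le_max lexx lead_coefN hornerN lerN2 => /(_ isT).
by apply/negP; rewrite -ltNge (lt_le_trans lp)// p_ge0 // le_max lexx orbT.
Qed.

(** The increasing function h e^G tends to 0 at infinity, so it starts below 0.
In terms of leading coefficients: if h(0) >= 0 then h stays nonnegative, its
leading coefficient is positive, and G' h, which dominates h', makes h' + G' h
negative at infinity. *)
Lemma start_lt0_of_weighted_monotone h G : lead_coef G^`() < 0 ->
  (forall x : R, 0 <= x -> 0 <= (h^`() + G^`() * h).[x]) ->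
  h^`() + G^`() * h != 0 -> h.[0] < 0.
Proof.
move=> lG f_ge0 f_neq0; rewrite ltNge; apply/negP => h0.
have h_ge0 := lead_coef_of_nonneg (nonneg_of_weighted_monotone f_ge0 h0).
have h_neq0 : h != 0 by apply: contraNneq f_neq0 => ->; rewrite linear0 mulr0 addr0.
have lh : 0 < lead_coef h by rewrite lt_def lead_coef_eq0 h_neq0.
have := lead_coef_of_nonneg f_ge0; rewrite lead_coefDr.
  by rewrite lead_coefM leNgt nmulr_rlt0 // lh.
have dG_neq0 : G^`() != 0 by rewrite -lead_coef_eq0 ltr0_neq0.
rewrite size_mul //; apply: (leq_trans (lt_size_deriv h_neq0)).
by rewrite -(prednK (_ : 0 < size G^`())%N) ?size_poly_gt0 //= leq_addl.
Qed.
End Decay.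

(** * Real and imaginary parts of complex polynomials *)

Section ReIm.
Variable R : rcfType.
Implicit Types p q : {poly R[i]}.

Definition rePoly p : {poly R} := \poly_(i < size p) Re p`_i.
Definition imPoly p : {poly R} := \poly_(i < size p) Im p`_i.

Lemma coef_rePoly p i : (rePoly p)`_i = Re p`_i.
Proof. by rewrite coef_poly; case: ltnP => // /(nth_default 0)->. Qed.

Lemma coef_imPoly p i : (imPoly p)`_i = Im p`_i.
Proof. by rewrite coef_poly; case: ltnP => // /(nth_default 0)->. Qed.

Lemma Re_add (x y : R[i]) : Re (x + y) = Re x + Re y.
Proof. by case: x; case: y. Qed.
Lemma Im_add (x y : R[i]) : Im (x + y) = Im x + Im y.
Proof. by case: x; case: y. Qed.
Lemma Re_mul (x y : R[i]) : Re (x * y) = Re x * Re y - Im x * Im y.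
Proof. by case: x; case: y. Qed.
Lemma Im_mul (x y : R[i]) : Im (x * y) = Re x * Im y + Im x * Re y.
Proof. by case: x; case: y. Qed.
Lemma Re_opp (x : R[i]) : Re (- x) = - Re x. Proof. by case: x. Qed.
Lemma Im_opp (x : R[i]) : Im (- x) = - Im x. Proof. by case: x. Qed.

Lemma rePolyD p q : rePoly (p + q) = rePoly p + rePoly q.
Proof. by apply/polyP => i; rewrite coefD !coef_rePoly coefD Re_add. Qed.
Lemma imPolyD p q : imPoly (p + q) = imPoly p + imPoly q.
Proof. by apply/polyP => i; rewrite coefD !coef_imPoly coefD Im_add. Qed.
Lemma rePolyN p : rePoly (- p) = - rePoly p.
Proof. by apply/polyP => i; rewrite coefN !coef_rePoly coefN Re_opp. Qed.
Lemma imPolyN p : imPoly (- p) = - imPoly p.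
Proof. by apply/polyP => i; rewrite coefN !coef_imPoly coefN Im_opp. Qed.

Lemma rePolyM p q : rePoly (p * q) = rePoly p * rePoly q - imPoly p * imPoly q.
Proof.
apply/polyP => i; rewrite coefB !coefM coef_rePoly coefM -sumrB.
rewrite (big_morph (@Re R) Re_add (erefl _)).
by apply: eq_bigr => j _; rewrite !coef_rePoly !coef_imPoly Re_mul.
Qed.

Lemma imPolyM p q : imPoly (p * q) = rePoly p * imPoly q + imPoly p * rePoly q.
Proof.
apply/polyP => i; rewrite coefD !coefM coef_imPoly coefM -big_split.
rewrite (big_morph (@Im R) Im_add (erefl _)).
by apply: eq_bigr => j _; rewrite !coef_rePoly !coef_imPoly Im_mul.
Qed.

Lemma rePolyC (z : R[i]) : rePoly z%:P = (Re z)%:P.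
Proof. by apply/polyP => i; rewrite coef_rePoly !coefC; case: (i == 0%N). Qed.
Lemma imPolyC (z : R[i]) : imPoly z%:P = (Im z)%:P.
Proof. by apply/polyP => i; rewrite coef_imPoly !coefC; case: (i == 0%N). Qed.

Lemma rePoly_real (p : {poly R}) : rePoly (map_poly (real_complex R) p) = p.
Proof. by apply/polyP => i; rewrite coef_rePoly coef_map. Qed.
Lemma imPoly_real (p : {poly R}) : imPoly (map_poly (real_complex R) p) = 0.
Proof. by apply/polyP => i; rewrite coef_imPoly coef_map coef0. Qed.

Lemma rePoly_deriv p : rePoly p^`() = (rePoly p)^`().
Proof.
apply/polyP => i; rewrite coef_rePoly !coef_deriv coef_rePoly.
by move: p`_i.+1 => c; elim: i.+1 => [|n IHn]; rewrite ?mulr0n // !mulrS Re_add IHn.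
Qed.
Lemma imPoly_deriv p : imPoly p^`() = (imPoly p)^`().
Proof.
apply/polyP => i; rewrite coef_imPoly !coef_deriv coef_imPoly.
by move: p`_i.+1 => c; elim: i.+1 => [|n IHn]; rewrite ?mulr0n // !mulrS Im_add IHn.
Qed.

End ReIm.

(** * Conservation of flux along a ray *)

Section Ray.
Variables (R : rcfType) (z : R[i]).
Implicit Types p q : {poly R}.

Definition along p : {poly R[i]} :=
  map_poly (real_complex R) p \Po (z%:P * 'X).

Lemma alongD p q : along (p + q) = along p + along q.
Proof. by rewrite /along rmorphD /= comp_polyD. Qed.
Lemma alongN p : along (- p) = - along p.
Proof. by rewrite /along rmorphN /= rmorphN. Qed.
Lemma alongM p q : along (p * q) = along p * along q.
Proof. by rewrite /along rmorphM /= comp_polyM. Qed.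

Lemma deriv_along p : (along p)^`() = z%:P * along p^`().
Proof.
by rewrite /along deriv_comp derivM derivC mul0r add0r derivX mulr1 mulrC deriv_map.
Qed.

(** With y(rho) = (p e^W)(rho z), this is Im(conj(y) y') divided by the positive
weight e^(2 Re W(rho z)). *)
Definition flux W p : {poly R} :=
  imPoly (z%:P * along (p^`() + W^`() * p)) * rePoly (along p)
  - rePoly (z%:P * along (p^`() + W^`() * p)) * imPoly (along p).

(** The derivative of Im(conj(y) y') is Im(conj(y) y''), and y'' = z^2 r y. The
second term on the left is the derivative of the weight. *)
Lemma flux_equation W r p :
  amplitude_op W^`() r p = 0 ->
  (flux W p)^`() + (rePoly (along (W *+ 2)))^`() * flux W p =
  imPoly (z%:P ^+ 2 * along r) * (rePoly (along p) ^+ 2 + imPoly (along p) ^+ 2).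
Proof.
rewrite /amplitude_op => ode; pose v := p^`() + W^`() * p.
have dp : p^`() = v - W^`() * p by rewrite /v addrK.
have dv : v^`() = r * p - W^`() * v.
  apply/eqP; rewrite -subr_eq0 -[X in _ == X]ode /v derivD derivM.
  by apply/eqP; ring.
rewrite mulr2n alongD rePolyD /flux -/v derivB !derivM derivD.
rewrite -!imPoly_deriv -!rePoly_deriv derivM derivC mul0r add0r.
rewrite !deriv_along dp dv !(alongD, alongN, alongM).
rewrite !(rePolyD, imPolyD, rePolyN, imPolyN, rePolyM, imPolyM, expr2).
ring.
Qed.

Lemma flux0 W p : (flux W p).[0] = Im z * (p.[0] * (p^`() + W^`() * p).[0]).
Proof.
have along0 q : (along q)`_0 = real_complex R q.[0].
  rewrite -horner_coef0 /along horner_comp hornerM hornerX mulr0.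
  by rewrite -[X in _.[X]](rmorph0 (real_complex R)) horner_map.
have re0 q : (rePoly (along q)).[0] = q.[0].
  by rewrite horner_coef0 coef_rePoly along0.
have im0 q : (imPoly (along q)).[0] = 0.
  by rewrite horner_coef0 coef_imPoly along0.
rewrite /flux !(rePolyM, imPolyM, rePolyC, imPolyC).
rewrite !(hornerD, hornerN, hornerM, hornerC) !im0 !re0.
rewrite !(hornerD, hornerN, hornerM, hornerC); ring.
Qed.
End Ray.

(** * Two incompatible rays *)

Section NoSolution.
Variable R : realType.
Implicit Types (z : R[i]) (N : R) (p : {poly R}).

Lemma coef_along z p i : (along z p)`_i = real_complex R p`_i * z ^+ i.
Proof.
rewrite /along comp_polyE coef_sum (bigID (fun j : 'I_ _ => j == i :> nat)) /=.
rewrite [X in _ + X]big1 ?addr0 => [|j ji]; last first.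
  rewrite exprMn -polyC_exp mul_polyC scalerA coefZ coefXn.
  by rewrite eq_sym (negPf ji) mulr0.
have [ip|pi] := ltnP i (size (map_poly (real_complex R) p)).
  rewrite (big_pred1 (Ordinal ip)) //=.
  by rewrite exprMn -polyC_exp mul_polyC scalerA coefZ coefXn eqxx mulr1 coef_map.
rewrite big1 => [|j /eqP ji]; last by move: (ltn_ord j); rewrite ji ltnNge pi.
by rewrite -coef_map nth_default ?mul0r.
Qed.

Lemma norm_along_neq0 z p : z != 0 -> p != 0 ->
  rePoly (along z p) ^+ 2 + imPoly (along z p) ^+ 2 != 0.
Proof.
move=> z0; apply: contra_neq => /eqP; rewrite addr_eq0.
move=> /eqP /(congr1 lead_coef) /eqP.
rewrite lead_coefN !lead_coef_exp -addr_eq0 paddr_eq0 ?sqr_ge0 //.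
rewrite !expf_eq0 /= !lead_coef_eq0 => /andP[/eqP re0 /eqP im0].
apply/polyP => i; apply/eqP; rewrite coef0.
have : (along z p)`_i = 0.
  apply/eqP; rewrite eq_complex -coef_rePoly -coef_imPoly re0 im0 !coef0.
  by rewrite eqxx.
move/eqP; rewrite coef_along mulf_eq0 expf_eq0 (negPf z0) andbF orbF.
by rewrite eq_complex /= eqxx andbT.
Qed.

(** On the ray of direction z, the weight decays when Re z^3 < 0, and
Im(z^2 r) = 4 N^2 (Im(z^6) rho^4 + 2 Im(z^5) rho^3). The factor e makes one
statement serve for both signs. *)
Lemma flux_start_sign N z p (e : R) : 0 < N -> p != 0 ->
  amplitude_op (scaled_action N)^`() (scaled_potential N) p = 0 ->
  Re (z ^+ 3) < 0 -> 0 < e * Im (z ^+ 5) -> 0 < e * Im (z ^+ 6) ->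
  e * (flux z (scaled_action N) p).[0] < 0.
Proof.
move=> N0 p0 ode z3 z5 z6.
set h := flux _ _ _; set W := scaled_action N.
have z0 : z != 0 by apply: contraTneq z3 => ->; rewrite expr0n ltxx.
rewrite -hornerZ.
have W3 : W`_3 = N * (2 / 3).
  by rewrite /W coefZ coefB coefD coefZ !coefXn coefX /= mulr1 addr0 subr0.
have lW : lead_coef (rePoly (along z (W *+ 2)))^`() = (W`_3 * Re (z ^+ 3)) *+ 6.
  have c2 : (rePoly (along z (W *+ 2)))^`()`_2 = (W`_3 * Re (z ^+ 3)) *+ 6.
    rewrite coef_deriv coef_rePoly coef_along coefMn Re_mul /= mul0r subr0.
    by rewrite mulrnAl -mulrnA.
  suff sz : size (rePoly (along z (W *+ 2)))^`() = 3 by rewrite lead_coefE sz.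
  apply/eqP; rewrite eqn_leq; apply/andP; split; last first.
    rewrite ltnNge; apply/negP => /leq_sizeP /(_ 2 (leqnn _)) /eqP.
    rewrite c2 mulrn_eq0 /= W3 mulf_eq0 (lt_eqF z3) orbF gt_eqF //.
    by rewrite mulr_gt0 // divr_gt0.
  apply/leq_sizeP => j j3; rewrite coef_deriv coef_rePoly coef_along coefMn.
  rewrite [W`_j.+1]nth_default ?mul0rn ?rmorph0 ?mul0r ?mul0rn //.
  apply: leq_trans (j3 : 4 <= j.+1)%N.
  apply/leq_sizeP => -[|[|[|[|k]]]] // _.
  by rewrite /W coefZ coefB coefD coefZ !coefXn coefX /= !mulr0 subr0 addr0 mulr0.
have M : imPoly (z%:P ^+ 2 * along z (scaled_potential N)) =
    (4 * N ^+ 2) *: (Im (z ^+ 6) *: 'X^4 + (2 * Im (z ^+ 5)) *: 'X^3).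
  apply/polyP => i; rewrite coef_imPoly -polyC_exp coefCM coef_along.
  rewrite !(coefZ, coefD, coefXn) mulrCA Im_mul /= mul0r addr0 -exprD -!mulrA.
  congr (_ * (_ * _)).
  have [->|_] := eqVneq i 4%N; first by rewrite /= !mulr0 !addr0 mulr1 mul1r.
  have [->|_] := eqVneq i 3%N; first by rewrite /= !mulr0 !add0r !mulr1.
  by rewrite !mulr0 addr0 mul0r.
have fE : (e *: h)^`() + (rePoly (along z (W *+ 2)))^`() * (e *: h) =
   ((4 * N ^+ 2) *: ((e * Im (z ^+ 6)) *: 'X^4 + (2 * (e * Im (z ^+ 5))) *: 'X^3))
   * (rePoly (along z p) ^+ 2 + imPoly (along z p) ^+ 2).
  rewrite derivZ -scalerAr -scalerDr (flux_equation z ode) M scalerAl; congr (_ * _).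
  by rewrite !scalerDr !scalerA; congr (_ *: _ + _ *: _); ring.
apply: (@start_lt0_of_weighted_monotone R (e *: h) (rePoly (along z (W *+ 2)))).
- by rewrite lW pmulrn_llt0 // W3 pmulr_rlt0 // mulr_gt0 // divr_gt0.
- move=> x x0; rewrite fE !(hornerXn, horner_exp, hornerZ, hornerD, hornerM).
  apply: mulr_ge0; last by rewrite addr_ge0 // sqr_ge0.
  apply: mulr_ge0; first by rewrite mulr_ge0 ?ler0n ?sqr_ge0.
  apply: addr_ge0; apply: mulr_ge0; rewrite ?exprn_ge0 // ?ltW //.
  by rewrite mulr_gt0 ?ltr0n.
- rewrite fE mulf_neq0 // ?norm_along_neq0 //.
  apply: contraTneq z6 => /(congr1 (fun q : {poly R} => q`_4)).
  rewrite !(coefZ, coefD, coefXn) coef0 /= mulr1 mulr0 addr0 => /eqP.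
  rewrite mulf_eq0 => /orP[|/eqP->]; last by rewrite ltxx.
  by rewrite gt_eqF // mulr_gt0 // exprn_gt0.
Qed.

Lemma real_amplitude_eq0 N p : 0 < N ->
  amplitude_op (scaled_action N)^`() (scaled_potential N) p = 0 -> p = 0.
Proof.
move=> N0 ode; apply/eqP/negPn/negP => p0.
(* The powers 3, 5 and 6 are -2+2i, -4-4i and -8i for z = 1+i, and -47-52i,
   1121+404i and -495+4888i for z = 1+4i. *)
have := @flux_start_sign N (Complex 1 1) p (-1) N0 p0 ode.
have := @flux_start_sign N (Complex 1 4) p 1 N0 p0 ode.
rewrite !flux0; set Y := (X in _ * (_ * X)).
rewrite !exprS !expr0 !mulr1 !(Re_mul, Im_mul) /=.
move=> H1 H2.
have {}H1 : 1 * (4 * Y) < 0 by apply: H1; lra.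
have {}H2 : -1 * (1 * Y) < 0 by apply: H2; lra.
lra.
Qed.
End NoSolution.

(** * Irreducibility *)

Section Complex.
Variable R : realType.

(** The coefficients of the equation are real, so the real and imaginary parts
of a complex solution are solutions. *)
Lemma complex_amplitude_eq0 (N : R) (p : {poly R[i]}) : 0 < N ->
  amplitude_op (scaled_action (real_complex R N))^`()
    (scaled_potential (real_complex R N)) p = 0 -> p = 0.
Proof.
move=> N0; have two : 2 = real_complex R 2 by rewrite rmorph_nat.
have -> : scaled_action (real_complex R N) =
    map_poly (real_complex R) (scaled_action N).
  rewrite /scaled_action map_polyZ rmorphB rmorphD /= map_polyZ !map_polyXn.
  by rewrite map_polyX fmorph_div !rmorph_nat.
have -> : scaled_potential (real_complex R N) =
    map_poly (real_complex R) (scaled_potential N).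
  rewrite /scaled_potential map_polyZ rmorphD /= map_polyZ !map_polyXn.
  by rewrite rmorphM rmorphXn !rmorph_nat.
set W := scaled_action N; set r := scaled_potential N.
rewrite /amplitude_op !deriv_map -rmorphXn -rmorphD -rmorphB /= => ode.
have re0 : rePoly p = 0.
  apply: (real_amplitude_eq0 N0); rewrite /amplitude_op -/W -/r.
  have := congr1 (@rePoly R) ode; rewrite mulr2n !rePolyD !rePolyM.
  by rewrite !rePoly_real !imPoly_real !rePoly_deriv !mul0r !subr0 rePolyC.
have im0 : imPoly p = 0.
  apply: (real_amplitude_eq0 N0); rewrite /amplitude_op -/W -/r.
  have := congr1 (@imPoly R) ode; rewrite mulr2n !imPolyD !imPolyM.
  by rewrite !rePoly_real !imPoly_real !imPoly_deriv !mul0r !addr0 imPolyC.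
apply/polyP => i; apply/eqP; rewrite coef0 eq_complex.
by rewrite -coef_rePoly -coef_imPoly re0 im0 !coef0 eqxx.
Qed.
End Complex.

Lemma order_S43 (R : realType) (a b : R[i]) : Defs.order (S43 a b) = 2%N.
Proof.
rewrite /Defs.order /S43 op_dX -[op_cst _ _]/(_%:P) size_polyDl ?size_polyXn //.
by rewrite size_polyN size_polyC ltnS (leq_trans (leq_b1 _)).
Qed.

Theorem proposition4 (R : realType) (a b : R[i]) (hab : a != 0 \/ b != 0) :
  irreducible_op (S43 a b).
Proof.
move=> /(order2_factors (order_S43 a b)) [A [B [A1 B1 SE]]].
have [u /riccati_log_derivative [q [w [q0 ode]]]] := riccati_of_factors A1 B1 SE.
have [p p0] := normalized_solution hab q0 ode.
rewrite -(rmorph_nat (real_complex R)) => /complex_amplitude_eq0 pE.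
by move: p0; rewrite pE ?eqxx // ltr0n size_poly_gt0.
Qed.
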